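(* For every $d\ge 2$, $$\mathrm{Aut}(\Gamma_d(q))\;\cong\; \mathrm{Der}\big(\mathbb Z^{d-1},\mathcal R_d(\mathbb Z_q)\big)\rtimes\Big(U(\mathcal R_d(\mathbb Z_q))\rtimes \mathcal K\Big),\qquad\text{where } \mathcal K=\{\beta\in \mathrm{Aut}(\mathbb Z^{d-1}) : K^{\beta}=K\}.$$
   Context: Let $d\ge 2$ and $q\ge 2$ be integers such that $d\le p+1$ for every prime $p$ dividing $q$, and write $\mathbb Z_q=\mathbb Z/q\mathbb Z$. Fix $l_1=0$ and $l_2,\dots,l_{d-1}\in\mathbb Z_q$ such that $l_i-l_j$ is invertible in $\mathbb Z_q$ whenever $i\ne j$. Let $\mathcal R_d(\mathbb Z_q)=\mathbb Z_q[t,(t+l_1)^{-1},\dots,(t+l_{d-1})^{-1}]$ (the localization of $\mathbb Z_q[t]$ at the elements $t+l_i$), and let $\Gamma_d(q)$ be the group, under matrix multiplication, of matrices $\begin{pmatrix}\prod_{i=1}^{d-1}(t+l_i)^{k_i} & P\\ 0&1\end{pmatrix}$ with $k_i\in\mathbb Z$, $P\in\mathcal R_d(\mathbb Z_q)$. Thus $\Gamma_d(q)\cong\mathcal R_d(\mathbb Z_q)\rtimes\mathbb Z^{d-1}$, where $\mathbf v=(v_1,\dots,v_{d-1})\in\mathbb Z^{d-1}$ acts on the additive group $\mathcal R_d(\mathbb Z_q)$ by $P^{\mathbf v}=P\prod_{i}(t+l_i)^{v_i}$. Let $\bigoplus_{\mathbb Z^{d-1}}\mathbb Z_q$ have generators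 $1_{\mathbf x}$ ($\mathbf x\in\mathbb Z^{d-1}$) and ring structure $1_{\mathbf v}1_{\mathbf w}=1_{\mathbf v+\mathbf w}$ (so it is the group ring of $\mathbb Z^{d-1}$ over $\mathbb Z_q$). Let $K$ be the kernel of the surjective ring homomorphism $\bigoplus_{\mathbb Z^{d-1}}\mathbb Z_q\to\mathcal R_d(\mathbb Z_q)$, $1_{\mathbf x}\mapsto\prod_i(t+l_i)^{x_i}$. The group $\mathrm{Aut}(\mathbb Z^{d-1})$ acts on $\bigoplus_{\mathbb Z^{d-1}}\mathbb Z_q$ by ring automorphisms via $1_{\mathbf v}^{\beta}=1_{\beta(\mathbf v)}$ (extended additively), and $K^\beta$ denotes the image of $K$ under $\beta$. If $K^\beta=K$, then $\beta$ induces a ring automorphism $S\mapsto S^\beta$ of $\mathcal R_d(\mathbb Z_q)$. $U(\cdot)$ denotes the group of units of a ring. $\mathrm{Der}(\mathbb Z^{d-1},\mathcal R_d(\mathbb Z_q))$ is the additive group of maps $\delta:\mathbb Z^{d-1}\to\mathcal R_d(\mathbb Z_q)$ with $\delta(\mathbf v+\mathbf w)=\delta(\mathbf v)+\delta(\mathbf w)^{\mathbf v}$. In $U(\mathcal R_d(\mathbb Z_q))\rtimes\mathcal K$ the product is $(R,\beta)(S,\gamma)=(RS^{\beta},\beta\gamma)$. This group acts on derivations by $\delta^{(R,\beta)}=\alpha_{R,\beta}\circ\delta\circ\beta^{-1}$, where $\alpha_{R,\beta}(S)=RS^\beta$ for $S\in\mathcal R_d(\mathbb Z_q)$. *)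

(* Defs.v *)
From HB Require Import structures.
From mathcomp Require Import all_boot all_order all_algebra.
From mathcomp Require Import finmap generic_quotient.
From mathcomp Require Import monalg.
From mathcomp Require Import boolp classical_sets.
From mathcomp Require Import ring.

Set Implicit Arguments.
Unset Strict Implicit.
Unset Printing Implicit Defensive.

Import GRing.Theory.

Local Open Scope ring_scope.
Local Open Scope quotient_scope.

(* Multiplicative subsets not containing 0, so that the localization is a
   nontrivial ring *)
Record mulset (A : comNzRingType) := MulSet {
  mulset_pred :> {pred A};
  mulset1 : 1 \in mulset_pred;
  mulsetM : forall x y, x \in mulset_pred -> y \in mulset_pred ->
    x * y \in mulset_pred;
  mulset0 : 0 \notin mulset_pred }.

(* The localization of A at S: fractions a / s modulo
   a / s ~ b / t <-> u (a t) = u (b s) for some u in S *)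
Module Loc.
Section Loc.
Variables (A : comNzRingType) (S : mulset A).

Definition dom := {x : A * A | x.2 \in S}.
HB.instance Definition _ := Choice.on dom.
Local Notation "\n_ x" := (val (x : dom)).1 (at level 8, x at level 2).
Local Notation "\d_ x" := (val (x : dom)).2 (at level 8, x at level 2).
Implicit Types x y z : dom.

Definition equiv x y :=
  `[< exists2 u, u \in S & u * (\n_x * \d_y) = u * (\n_y * \d_x) >].

Lemma equiv_refl : reflexive equiv.
Proof. by move=> x; apply/asboolP; exists 1 => //; exact: mulset1. Qed.

Lemma equiv_sym : symmetric equiv.
Proof. by move=> x y; apply/asboolP/asboolP => -[u uS e]; exists u. Qed.

Lemma equiv_trans : transitive equiv.
Proof.
move=> y x z /asboolP[u uS e] /asboolP[v vS f]; apply/asboolP.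
exists (u * v * \d_y); first by do 2?apply: mulsetM => //; exact: (valP y).
transitivity (v * \d_z * (u * (\n_x * \d_y))); first by ring.
rewrite e; transitivity (u * \d_x * (v * (\n_y * \d_z))); first by ring.
by rewrite f; ring.
Qed.

Canonical equiv_equiv := EquivRel equiv equiv_refl equiv_sym equiv_trans.

Definition type := {eq_quot equiv}.
HB.instance Definition _ : EqQuotient _ equiv type := EqQuotient.on type.
HB.instance Definition _ := Choice.on type.

Lemma eqmodP_ x y : x = y %[mod type] <->
  exists2 u, u \in S & u * (\n_x * \d_y) = u * (\n_y * \d_x).
Proof.
split=> [/eqmodP/asboolP//|h].
by apply/eqmodP/asboolP.
Qed.

Definition frac (a b : A) (bS : b \in S) : dom := exist _ (a, b) bS.

Definition addf x y : dom :=
  frac (\n_x * \d_y + \n_y * \d_x) (mulsetM (valP x) (valP y)).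
Definition oppf x : dom := frac (- \n_x) (valP x).
Definition mulf x y : dom :=
  frac (\n_x * \n_y) (mulsetM (valP x) (valP y)).

Definition embed (a : A) : type := \pi_type (frac a (mulset1 S)).
Definition add := lift_op2 type addf.
Definition opp := lift_op1 type oppf.
Definition mul := lift_op2 type mulf.

Lemma reprP x : exists2 u, u \in S &
  u * (\n_(repr (\pi_type x)) * \d_x) = u * (\n_x * \d_(repr (\pi_type x))).
Proof. by apply/eqmodP_; rewrite reprK. Qed.

Lemma pi_add x y : add (\pi_type x) (\pi_type y) = \pi_type (addf x y).
Proof.
unlock add; apply/eqmodP_ => /=.
have [u uS e] := reprP x; have [v vS f] := reprP y.
exists (u * v); first exact: mulsetM.
set x' := repr _ in e *; set y' := repr _ in f *.
transitivity (v * \d_y' * \d_y * (u * (\n_x' * \d_x)) +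
  u * \d_x' * \d_x * (v * (\n_y' * \d_y))); first by ring.
by rewrite e f; ring.
Qed.

Lemma pi_opp x : opp (\pi_type x) = \pi_type (oppf x).
Proof.
unlock opp; apply/eqmodP_ => /=; have [u uS e] := reprP x; exists u => //.
by rewrite !mulNr !mulrN e.
Qed.

Lemma pi_mul x y : mul (\pi_type x) (\pi_type y) = \pi_type (mulf x y).
Proof.
unlock mul; apply/eqmodP_ => /=.
have [u uS e] := reprP x; have [v vS f] := reprP y.
exists (u * v); first exact: mulsetM.
set x' := repr _ in e *; set y' := repr _ in f *.
transitivity ((u * (\n_x' * \d_x)) * (v * (\n_y' * \d_y))); first by ring.
by rewrite e f; ring.
Qed.

Ltac loc_ring :=
  rewrite /embed ?pi_add ?pi_opp ?pi_mul ?pi_add; apply/eqmodP_ => /=;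
  exists 1; [exact: mulset1|rewrite /=; ring].

Lemma addA : associative add.
Proof. by elim/quotW=> x; elim/quotW=> y; elim/quotW=> z;
  rewrite !pi_add; loc_ring. Qed.
Lemma addC : commutative add.
Proof. by elim/quotW=> x; elim/quotW=> y; loc_ring. Qed.
Lemma add0_l : left_id (embed 0) add.
Proof. by elim/quotW=> x; loc_ring. Qed.
Lemma addN_l : left_inverse (embed 0) opp add.
Proof. by elim/quotW=> x; loc_ring. Qed.
HB.instance Definition _ := GRing.isZmodule.Build type addA addC add0_l addN_l.

Lemma mulA : associative mul.
Proof. by elim/quotW=> x; elim/quotW=> y; elim/quotW=> z;
  rewrite !pi_mul; loc_ring. Qed.
Lemma mulC : commutative mul.
Proof. by elim/quotW=> x; elim/quotW=> y; loc_ring. Qed.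
Lemma mul1_l : left_id (embed 1) mul.
Proof. by elim/quotW=> x; loc_ring. Qed.
Lemma mul_addl : left_distributive mul add.
Proof.
by elim/quotW=> x; elim/quotW=> y; elim/quotW=> z;
  rewrite !(pi_add, pi_mul); loc_ring.
Qed.
Lemma nonzero1 : embed 1 != embed 0.
Proof.
apply/eqP => /eqmodP_[u uS /=]; rewrite !mulr1 mulr0 => u0.
by have := mulset0 S; rewrite -u0 uS.
Qed.
HB.instance Definition _ :=
  GRing.Zmodule_isComNzRing.Build type mulA mulC mul1_l mul_addl nonzero1.

Definition unit (a : type) := `[< exists b : type, b * a = 1 >].
Definition inv (a : type) : type :=
  xget a [set b : type | b * a = 1].

Lemma mulVx : {in unit, left_inverse 1 inv *%R}.
Proof.
move=> a /asboolP h; rewrite /inv; case: xgetP => [b _ //|].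
by case: h => b ba /(_ b).
Qed.
Lemma unitP_ (a b : type) : b * a = 1 -> unit a.
Proof. by move=> h; apply/asboolP; exists b. Qed.
Lemma inv_out : {in [predC unit], inv =1 id}.
Proof.
move=> a /asboolP h; rewrite /inv; case: xgetP => // b _ /= ba.
by case: h; exists b.
Qed.
HB.instance Definition _ :=
  GRing.ComNzRing_hasMulInverse.Build type mulVx unitP_ inv_out.

Lemma embed_zmod : zmod_morphism embed.
Proof.
by move=> a b; rewrite [X in _ = _ + X]pi_opp [RHS]pi_add; loc_ring.
Qed.
Lemma embed_monoid : monoid_morphism embed.
Proof. by split=> // a b; rewrite [RHS]pi_mul; loc_ring. Qed.
HB.instance Definition _ := GRing.isZmodMorphism.Build A type embed embed_zmod.
HB.instance Definition _ :=
  GRing.isMonoidMorphism.Build A type embed embed_monoid.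

Lemma embed_unit s : s \in S -> embed s \is a GRing.unit.
Proof.
move=> sS; apply/unitrP; exists (\pi_type (frac 1 sS)).
by rewrite mulrC; split; rewrite [LHS]pi_mul; loc_ring.
Qed.

Lemma fracE (a : type) : exists n s, s \in S /\ a = embed n / embed s.
Proof.
elim/quotW: a => x; exists \n_x, \d_x; split; first exact: (valP x).
apply: (mulIr (embed_unit (valP x))); rewrite divrK ?embed_unit ?(valP x) //.
by rewrite [LHS]pi_mul; loc_ring.
Qed.

End Loc.
End Loc.
HB.export Loc.

(* The group ring A[G] of an additive abelian group G: {malg A[G]} has no ring
   structure in multinomials when G is a group, as a monomType has no
   nontrivial invertible element. Below, [gbasis x a] is a 1_x, [glift F] is the
   additive extension of a 1_x |-> F x a, and the product is the additive
   extension of (a 1_x) (b 1_y) = ab 1_(x + y). *)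
Definition gring (A : comNzRingType) (G : zmodType) := {malg A[G]}.
HB.instance Definition _ A G := GRing.Zmodule.on (gring A G).

HB.lock Definition gbasis (A : comNzRingType) (G : zmodType) (x : G) (a : A) :
  gring A G := mkmalgU x a.

HB.lock Definition glift (A : comNzRingType) (G V : zmodType) (F : G -> A -> V)
  (g : gring A G) : V := \sum_(x <- msupp g) F x (mcoeff x g).

Section GroupRing.
Variables (A : comNzRingType) (G : zmodType).
Local Notation gring := (gring A G).
Local Notation gbasis := (@gbasis A G).

Section Lift.
Variables (V : zmodType) (F : G -> A -> V).
Local Notation glift := (glift F).

Hypothesis Fadd : forall x, zmod_morphism (F x).

Let F0 x : F x 0 = 0.
Proof. by rewrite -[X in F x X](subrr 0) Fadd subrr. Qed.

Lemma gliftEw (d : {fset G}) (g : gring) : (msupp g `<=` d)%fset ->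
  glift g = \sum_(x <- d) F x (mcoeff x g).
Proof.
rewrite glift.unlock => le.
by apply: big_fset_incl => // x _ /mcoeff_outdom ->.
Qed.

Lemma glift_zmod : zmod_morphism glift.
Proof.
move=> g h; pose d := (msupp g `|` msupp h `|` msupp (g - h))%fset.
rewrite !(@gliftEw d).
- by rewrite -sumrB; apply: eq_bigr => x _; rewrite mcoeffB Fadd.
- by apply: (fsubset_trans _ (fsubsetUl _ _)); apply: fsubsetUr.
- by apply: (fsubset_trans _ (fsubsetUl _ _)); apply: fsubsetUl.
- exact: fsubsetUr.
Qed.

Lemma gliftU x a : glift (gbasis x a) = F x a.
Proof.
by rewrite gbasis.unlock (gliftEw (msuppU_le)) big_seq_fset1 mcoeffUU.
Qed.
End Lift.

Lemma gbasis_zmod x : zmod_morphism (gbasis x).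
Proof. by move=> a b; rewrite gbasis.unlock monalgUB. Qed.

Lemma zmod_sum (U V : zmodType) (f : U -> V) (fB : zmod_morphism f)
  (I : Type) (r : seq I) (F : I -> U) :
  f (\sum_(i <- r) F i) = \sum_(i <- r) f (F i).
Proof.
pose fM := GRing.isZmodMorphism.Build U V f fB.
pose fL : {additive U -> V} := HB.pack f fM.
exact: (raddf_sum fL).
Qed.

Lemma gring_ext (V : zmodType) (f h : gring -> V) :
  zmod_morphism f -> zmod_morphism h ->
  (forall x a, f (gbasis x a) = h (gbasis x a)) -> f =1 h.
Proof.
move=> fB hB fh g; rewrite (monalgE g) !zmod_sum //.
by apply: eq_bigr => x _; have := fh x (mcoeff x g); rewrite gbasis.unlock.
Qed.

Lemma zmod_morphD (U V : zmodType) (f : U -> V) :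
  zmod_morphism f -> {morph f : x y / x + y}.
Proof.
move=> fB x y; have f0 : f 0 = 0 by rewrite -[X in f X](subrr x) fB subrr.
by rewrite -{1}[y]opprK fB -[- y]sub0r fB f0 sub0r opprK.
Qed.

Lemma zmod_comp (U V W : zmodType) (f : V -> W) (h : U -> V) :
  zmod_morphism f -> zmod_morphism h -> zmod_morphism (fun x => f (h x)).
Proof. by move=> fB hB x y; rewrite hB fB. Qed.

Definition gmul (g h : gring) : gring :=
  glift (fun x a => glift (fun y b => gbasis (x + y) (a * b)) h) g.

Let gmul_inner x a : zmod_morphism
  (glift (fun y b => gbasis (x + y) (a * b))).
Proof. by apply: glift_zmod => y b c; rewrite mulrBr gbasis_zmod. Qed.

Let gmul_outer h x : zmod_morphism
  (fun a => glift (fun y b => gbasis (x + y) (a * b)) h).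
Proof.
move=> a b; rewrite glift.unlock -sumrB; apply: eq_bigr => y _.
by rewrite mulrBl gbasis_zmod.
Qed.

Lemma gmul_zmodl h : zmod_morphism (gmul^~ h).
Proof. exact: glift_zmod. Qed.

Lemma gmulUg x a h :
  gmul (gbasis x a) h = glift (fun y b => gbasis (x + y) (a * b)) h.
Proof. exact: gliftU. Qed.

Lemma gmul_zmodr g : zmod_morphism (gmul g).
Proof.
move=> h k; apply: (@gring_ext _ (gmul^~ (h - k))
  (fun g => gmul g h - gmul g k)).
- exact: gmul_zmodl.
- move=> a b; rewrite !gmul_zmodl !opprB addrACA [RHS]addrACA.
  by congr (_ + _); exact: addrC.
- by move=> x a; rewrite !gmulUg gmul_inner.
Qed.

Lemma gmulUU x a y b :
  gmul (gbasis x a) (gbasis y b) = gbasis (x + y) (a * b).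
Proof.
by rewrite gmulUg gliftU // => z c d; rewrite mulrBr gbasis_zmod.
Qed.

Lemma gmulC : commutative gmul.
Proof.
move=> g h; apply: (@gring_ext _ (gmul^~ h) (gmul h)) g => [||x a].
- exact: gmul_zmodl.
- exact: gmul_zmodr.
apply: (@gring_ext _ (gmul _) (gmul^~ (gbasis x a))) h => [||y b].
- exact: gmul_zmodr.
- exact: gmul_zmodl.
by rewrite !gmulUU addrC mulrC.
Qed.

Lemma gmulA : associative gmul.
Proof.
move=> g h k; apply: (@gring_ext _ (gmul^~ _) (fun g => gmul (gmul g h) k)) g
  => [||x a].
- exact: gmul_zmodl.
- exact: (zmod_comp (@gmul_zmodl k) (@gmul_zmodl h)).
apply: (@gring_ext _ (fun h => gmul _ (gmul h k))
  (fun h => gmul (gmul _ h) k)) h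
  => [||y b].
- exact: (zmod_comp (@gmul_zmodr _) (@gmul_zmodl k)).
- exact: (zmod_comp (@gmul_zmodl k) (@gmul_zmodr _)).
apply: (@gring_ext _ (fun k => gmul _ (gmul _ k)) (gmul _)) k => [||z c].
- exact: (zmod_comp (@gmul_zmodr _) (@gmul_zmodr _)).
- exact: gmul_zmodr.
by rewrite !gmulUU addrA mulrA.
Qed.

Lemma gmul1g : left_id (gbasis 0 1) gmul.
Proof.
apply: gring_ext => [||x a]; first exact: gmul_zmodr.
- by [].
by rewrite gmulUU add0r mul1r.
Qed.

Lemma gmulDl : left_distributive gmul +%R.
Proof.
by move=> g h k; exact: (zmod_morphD (gmul_zmodl k)).
Qed.

Lemma gbasis01_neq0 : gbasis 0 1 != 0 :> gring.
Proof. by rewrite gbasis.unlock monalgU_eq0 oner_eq0. Qed.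

HB.instance Definition _ := GRing.Zmodule_isComNzRing.Build gring
  gmulA gmulC gmul1g gmulDl gbasis01_neq0.

Lemma gbasisM x a y b : gbasis x a * gbasis y b = gbasis (x + y) (a * b).
Proof. exact: gmulUU. Qed.

(* g |-> g^beta, the additive extension of 1_x |-> 1_(beta x) *)
Definition gpush (beta : G -> G) : gring -> gring :=
  glift (fun x a => gbasis (beta x) a).

Lemma gpush_zmod beta : zmod_morphism (gpush beta).
Proof. by apply: glift_zmod => x; exact: gbasis_zmod. Qed.

Lemma gpushU beta x a : gpush beta (gbasis x a) = gbasis (beta x) a.
Proof. by rewrite /gpush gliftU // => y; exact: gbasis_zmod. Qed.

Lemma gpush_id : gpush id =1 id.
Proof.
by apply: gring_ext => [||x a] //; [exact: gpush_zmod|rewrite gpushU].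
Qed.

Lemma gpush_comp beta gamma g :
  gpush (beta \o gamma) g = gpush beta (gpush gamma g).
Proof.
apply: (@gring_ext _ (gpush _) (fun g => gpush beta (gpush gamma g))) g
  => [||x a]; first exact: gpush_zmod.
- exact: (zmod_comp (gpush_zmod _) (gpush_zmod _)).
by rewrite !gpushU.
Qed.

Lemma gpush_monoid beta : {morph beta : x y / x + y} ->
  monoid_morphism (gpush beta).
Proof.
move=> betaD; have beta0 : beta 0 = 0.
  by apply: (addrI (beta 0)); rewrite -betaD !addr0.
split=> [|g h]; first by rewrite gpushU beta0.
apply: (@gring_ext _ (fun g => gpush beta (g * h))
  (fun g => gpush beta g * gpush beta h)) g => [||x a].
- exact: (zmod_comp (gpush_zmod _) (gmul_zmodl _)).
- exact: (zmod_comp (gmul_zmodl _) (gpush_zmod _)).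
apply: (@gring_ext _ (fun h => gpush beta (_ * h))
  (fun h => _ * gpush beta h)) h => [||y b].
- exact: (zmod_comp (gpush_zmod _) (gmul_zmodr _)).
- exact: (zmod_comp (gmul_zmodr _) (gpush_zmod _)).
by rewrite gbasisM !gpushU gbasisM betaD.
Qed.
End GroupRing.

Section LocalizedPolynomials.
Variables (A : comNzRingType) (n : nat) (l : 'I_n.+1 -> A).

(* 'X plays the role of t, and n.+1 that of d - 1 *)
Definition lfactor i : {poly A} := 'X + (l i)%:P.

Definition lprods : {pred {poly A}} := fun p =>
  `[< exists e : 'I_n.+1 -> nat, p = \prod_i lfactor i ^+ e i >].

Lemma lprods1 : 1 \in lprods.
Proof. by apply/asboolP; exists (fun=> 0%N); rewrite big1. Qed.

Lemma lprodsM p q : p \in lprods -> q \in lprods -> p * q \in lprods.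
Proof.
move=> /asboolP[e ->] /asboolP[f ->]; apply/asboolP.
exists (fun i => e i + f i)%N; rewrite -big_split /=.
by apply: eq_bigr => i _; rewrite exprD.
Qed.

Lemma lprods0 : 0 \notin lprods.
Proof.
apply/asboolP => -[e /esym/eqP]; apply/negP/monic_neq0/monic_prod => i _.
by apply: monic_exp; exact: monicXaddC.
Qed.

Lemma lfactor_lprods i : lfactor i \in lprods.
Proof.
apply/asboolP; exists (fun j => (j == i) : nat).
rewrite (bigD1 i) //= eqxx expr1 big1 ?mulr1 // => j /negPf ->.
by rewrite expr0.
Qed.

Definition lmulset : mulset {poly A} := MulSet lprods1 lprodsM lprods0.

(* A[t, (t + l_i)^-1 for all i] *)
Definition Rd : Type := Loc.type lmulset.
HB.instance Definition _ := GRing.ComUnitRing.on Rd.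

Definition poly_to_Rd : {poly A} -> Rd := @Loc.embed _ lmulset.
HB.instance Definition _ := GRing.RMorphism.on poly_to_Rd.

Local Notation Z := 'rV[int]_n.+1.

Definition lmonom (v : Z) : Rd := \prod_i poly_to_Rd (lfactor i) ^ v 0 i.

Lemma lfactor_unit i : poly_to_Rd (lfactor i) \is a GRing.unit.
Proof. by apply: Loc.embed_unit; exact: lfactor_lprods. Qed.

Lemma lmonomD v w : lmonom (v + w) = lmonom v * lmonom w.
Proof.
rewrite -big_split /=; apply: eq_bigr => i _.
by rewrite mxE exprzDr ?lfactor_unit.
Qed.

Lemma lmonom0 : lmonom 0 = 1.
Proof. by apply: big1 => i _; rewrite mxE expr0z. Qed.

Lemma lmonom_unit v : lmonom v \is a GRing.unit.
Proof.
apply/unitrP; exists (lmonom (- v)).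
by rewrite -!lmonomD addNr addrN lmonom0.
Qed.

Lemma lmonomE (e : 'I_n.+1 -> nat) :
  lmonom (\row_i (e i)%:Z) = poly_to_Rd (\prod_i lfactor i ^+ e i).
Proof. by rewrite rmorph_prod; apply: eq_bigr => i _; rewrite mxE rmorphXn. Qed.

Definition group_ring_map : gring A Z -> Rd :=
  glift (fun x a => poly_to_Rd a%:P * lmonom x).

Lemma group_ring_mapU x a :
  group_ring_map (gbasis x a) = poly_to_Rd a%:P * lmonom x.
Proof. by apply: gliftU => y b c; rewrite polyCB rmorphB mulrBl. Qed.

Lemma group_ring_map_zmod : zmod_morphism group_ring_map.
Proof. by apply: glift_zmod => x a b; rewrite polyCB rmorphB mulrBl. Qed.

Lemma group_ring_map_monoid : monoid_morphism group_ring_map.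
Proof.
split=> [|g h]; first by rewrite group_ring_mapU rmorph1 mul1r lmonom0.
apply: (@gring_ext _ _ _ (fun g => group_ring_map (g * h))
  (fun g => group_ring_map g * group_ring_map h)) g => [a b|a b|x a].
- by rewrite mulrBl group_ring_map_zmod.
- by rewrite group_ring_map_zmod mulrBl.
apply: (@gring_ext _ _ _ (fun h => group_ring_map (_ * h))
  (fun h => _ * group_ring_map h)) h => [b c|b c|y b].
- by rewrite mulrBr group_ring_map_zmod.
- by rewrite group_ring_map_zmod mulrBr.
by rewrite gbasisM !group_ring_mapU lmonomD polyCM rmorphM mulrACA.
Qed.

HB.instance Definition _ := GRing.isZmodMorphism.Build (gring A Z) Rd
  group_ring_map group_ring_map_zmod.
HB.instance Definition _ := GRing.isMonoidMorphism.Build (gring A Z) Rd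
  group_ring_map group_ring_map_monoid.

Lemma group_ring_map_surj S : exists g, group_ring_map g = S.
Proof.
have mapC c : group_ring_map (gbasis 0 c) = poly_to_Rd c%:P.
  by rewrite group_ring_mapU lmonom0 mulr1.
have mapX : exists g, group_ring_map g = poly_to_Rd 'X.
  exists (gbasis (delta_mx 0 ord0) 1 - gbasis 0 (l ord0)).
  rewrite rmorphB /= mapC group_ring_mapU rmorph1 mul1r.
  rewrite -[delta_mx 0 _](_ : \row_i ((i == ord0) : nat)%:Z = _).
    rewrite lmonomE (bigD1 ord0) //= expr1 big1.
      by rewrite mulr1 -rmorphB addrK.
    by move=> j /negPf ->; rewrite expr0.
  by apply/rowP => i; rewrite !mxE /=; case: (i == ord0).
have mapP p : exists g, group_ring_map g = poly_to_Rd p.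
  elim/poly_ind: p => [|p c [g gp]]; first by exists 0; rewrite !rmorph0.
  have [h hX] := mapX; exists (g * h + gbasis 0 c).
  by rewrite rmorphD rmorphM /= gp hX mapC rmorphD rmorphM.
have [p [s [/asboolP[e ->] ->]]] := Loc.fracE S.
have [g gp] := mapP p; exists (g * gbasis (- \row_i (e i)%:Z) 1).
rewrite rmorphM /= gp group_ring_mapU rmorph1 mul1r.
rewrite -[Loc.embed lmulset (\prod_i _)]/(poly_to_Rd _) -lmonomE.
by apply: (mulIr (lmonom_unit (\row_i (e i)%:Z)));
  rewrite divrK ?lmonom_unit // -mulrA -lmonomD addNr lmonom0 mulr1.
Qed.

Local Open Scope classical_set_scope.

Definition group_ring_ker : set (gring A Z) := [set g | group_ring_map g = 0].

Definition ker_stable (beta : Z -> Z) :=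
  [/\ bijective beta, {morph beta : v w / v + w} &
      gpush beta @` group_ring_ker = group_ring_ker].

(* S |-> S^beta, induced by gpush beta on the quotient of the group ring by
   group_ring_ker. A preimage of S exists by group_ring_map_surj, and when beta
   stabilizes the kernel its choice does not matter (Rd_act_map). *)
Definition Rd_act (beta : Z -> Z) (S : Rd) : Rd :=
  group_ring_map (gpush beta (xget 0 [set g | group_ring_map g = S])).

Lemma Rd_act_map beta g : ker_stable beta ->
  Rd_act beta (group_ring_map g) = group_ring_map (gpush beta g).
Proof.
move=> [_ _ bK]; rewrite /Rd_act; case: xgetP; last first.
  by move=> /(_ g) h; exfalso; apply: h; reflexivity.
move=> h _ /= hg; apply/subr0_eq; rewrite -group_ring_map_zmod -gpush_zmod.
have : (gpush beta @` group_ring_ker) (gpush beta (h - g)).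
  exists (h - g); last by [].
  by rewrite /group_ring_ker /= group_ring_map_zmod hg subrr.
by rewrite bK.
Qed.

Lemma Rd_act_zmod beta : ker_stable beta -> zmod_morphism (Rd_act beta).
Proof.
move=> bK S T; have [g <-] := group_ring_map_surj S.
have [h <-] := group_ring_map_surj T.
by rewrite -group_ring_map_zmod !Rd_act_map // gpush_zmod group_ring_map_zmod.
Qed.

Lemma Rd_act_monoid beta : ker_stable beta -> monoid_morphism (Rd_act beta).
Proof.
move=> bK; have [_ bD _] := bK; have [g1 gM] := gpush_monoid A bD.
have [m1 mM] := group_ring_map_monoid.
split=> [|S T]; first by rewrite -m1 Rd_act_map // g1.
have [g <-] := group_ring_map_surj S; have [h <-] := group_ring_map_surj T.
by rewrite -mM !Rd_act_map // gM mM.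
Qed.

Lemma Rd_act_lmonom beta v : ker_stable beta ->
  Rd_act beta (lmonom v) = lmonom (beta v).
Proof.
have mapE w : group_ring_map (gbasis w 1) = lmonom w.
  by rewrite group_ring_mapU rmorph1 mul1r.
by move=> bK; rewrite -!mapE Rd_act_map // gpushU.
Qed.

Lemma ker_stable_id : ker_stable id.
Proof.
split=> //; first by exists id.
rewrite (_ : gpush id = id) ?image_id //.
by apply/funext => g; exact: gpush_id.
Qed.

Lemma ker_stable_comp beta gamma :
  ker_stable beta -> ker_stable gamma -> ker_stable (beta \o gamma).
Proof.
move=> [bb bD bK] [gb gD gK]; split; first exact: bij_comp.
  by move=> v w /=; rewrite gD bD.
rewrite (_ : gpush (beta \o gamma) = gpush beta \o gpush gamma); last first.
  by apply/funext => g; exact: gpush_comp.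
by rewrite -image_comp gK bK.
Qed.

Lemma ker_stable_inv beta gamma : cancel beta gamma -> cancel gamma beta ->
  ker_stable beta -> ker_stable gamma.
Proof.
move=> bg gb [_ bD bK]; split; first by exists beta.
  by move=> v w; apply: (can_inj bg); rewrite bD !gb.
rewrite -{1}bK image_comp (_ : gpush gamma \o gpush beta = id) ?image_id //.
apply/funext => g /=; rewrite -gpush_comp (_ : gamma \o beta = id) ?gpush_id //.
exact/funext.
Qed.

Lemma Rd_act_id : Rd_act id =1 id.
Proof.
move=> S; have [g <-] := group_ring_map_surj S.
by rewrite Rd_act_map ?gpush_id //; exact: ker_stable_id.
Qed.

Lemma Rd_act_comp beta gamma S : ker_stable beta -> ker_stable gamma ->
  Rd_act (beta \o gamma) S = Rd_act beta (Rd_act gamma S).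
Proof.
move=> bK gK; have [g <-] := group_ring_map_surj S.
by rewrite (Rd_act_map g (ker_stable_comp bK gK)) (Rd_act_map g gK)
  (Rd_act_map _ bK) gpush_comp.
Qed.
End LocalizedPolynomials.
Arguments Rd_act {A n} l beta S.

(* Groups of bijections of T, under composition: (f * g) x = f (g x) *)
Section BijectionGroup.

Record bijset (T : Type) := BijSet {
  bijset_set :> (T -> T) -> Prop;
  bijset_bij : forall f, bijset_set f -> bijective f;
  bijset_id : bijset_set id;
  bijset_comp : forall f g, bijset_set f -> bijset_set g ->
    bijset_set (f \o g);
  bijset_inv : forall f g, cancel f g -> cancel g f ->
    bijset_set f -> bijset_set g }.

Variables (T : choiceType) (B : bijset T).

Record bijgrp := Bijgrp { bijfun :> T -> T; _ : `[< B bijfun >] }.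

HB.instance Definition _ := [isSub for bijfun].
HB.instance Definition _ := [Choice of bijgrp by <:].

Lemma bijgrpP (f : bijgrp) : B f.
Proof. by case: f => f fB; apply/asboolP. Qed.

Lemma bijgrp_ext (f g : bijgrp) : f =1 g -> f = g.
Proof. by move=> fg; apply: val_inj; apply/funext. Qed.

Definition to_bijgrp f (fB : B f) : bijgrp := Bijgrp (introT (asboolP _) fB).

Definition bijgrp_one : bijgrp := to_bijgrp (bijset_id B).
Definition bijgrp_mul (f g : bijgrp) : bijgrp :=
  to_bijgrp (bijset_comp (bijgrpP f) (bijgrpP g)).

Lemma bijgrp_inv_ex (f : bijgrp) :
  exists g : bijgrp, cancel f g /\ cancel g f.
Proof.
have [g fg gf] := bijset_bij (bijgrpP f).
by exists (to_bijgrp (bijset_inv fg gf (bijgrpP f))).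
Qed.

Definition bijgrp_inv (f : bijgrp) : bijgrp := projT1 (cid (bijgrp_inv_ex f)).

Lemma bijgrp_invK (f : bijgrp) : cancel f (bijgrp_inv f).
Proof. by rewrite /bijgrp_inv; case: cid => g [fg gf]. Qed.
Lemma bijgrp_Kinv (f : bijgrp) : cancel (bijgrp_inv f) f.
Proof. by rewrite /bijgrp_inv; case: cid => g [fg gf]. Qed.

Lemma bijgrp_mulA : associative bijgrp_mul.
Proof. by move=> f g h; exact: bijgrp_ext. Qed.
Lemma bijgrp_mul1 : left_id bijgrp_one bijgrp_mul.
Proof. by move=> f; exact: bijgrp_ext. Qed.
Lemma bijgrp_1mul : right_id bijgrp_one bijgrp_mul.
Proof. by move=> f; exact: bijgrp_ext. Qed.
Lemma bijgrp_mulV : left_inverse bijgrp_one bijgrp_inv bijgrp_mul.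
Proof. by move=> f; apply: bijgrp_ext => x; exact: bijgrp_invK. Qed.
Lemma bijgrp_Vmul : right_inverse bijgrp_one bijgrp_inv bijgrp_mul.
Proof. by move=> f; apply: bijgrp_ext => x; exact: bijgrp_Kinv. Qed.
HB.instance Definition _ := isGroup.Build bijgrp
  bijgrp_mulA bijgrp_mul1 bijgrp_1mul bijgrp_mulV bijgrp_Vmul.
End BijectionGroup.

Section Automorphisms.
Variable G : groupType.
Local Open Scope group_scope.

Definition is_aut (f : G -> G) : Prop :=
  bijective f /\ {morph f : x y / x * y}.

Lemma is_aut_bij f : is_aut f -> bijective f. Proof. by case. Qed.
Lemma is_aut_id : is_aut id. Proof. by split=> //; exists id. Qed.
Lemma is_aut_comp f g : is_aut f -> is_aut g -> is_aut (f \o g).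
Proof.
by move=> [fb fM] [gb gM]; split=> [|x y /=]; [exact: bij_comp|rewrite gM fM].
Qed.
Lemma is_aut_inv f g : cancel f g -> cancel g f -> is_aut f -> is_aut g.
Proof.
move=> fg gf [_ fM]; split=> [|x y]; first by exists f.
by apply: (can_inj fg); rewrite fM !gf.
Qed.

Definition autgrp : Type :=
  bijgrp (BijSet is_aut_bij is_aut_id is_aut_comp is_aut_inv).
HB.instance Definition _ := Group.on autgrp.
End Automorphisms.

Section SemidirectProduct.
Local Open Scope group_scope.

Record group_action (H N : groupType) := GroupAction {
  group_act :> H -> N -> N;
  group_act1 : forall x, group_act 1 x = x;
  group_actM : forall h k x, group_act (h * k) x = group_act h (group_act k x);
  group_act_morph : forall h, {morph group_act h : x y / x * y} }.

(* N ><| H, with product (x, h) (y, k) = (x (h . y), h k) *)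
Definition semidirect (N H : groupType) (act : group_action H N) : Type :=
  (N * H)%type.
Arguments semidirect : clear implicits.

Variables (N H : groupType) (act : group_action H N).
Local Notation sdp := (semidirect N H act).

HB.instance Definition _ := Choice.copy sdp (N * H)%type.

Definition sd_one : sdp := (1, 1).
Definition sd_mul (x y : sdp) : sdp :=
  (x.1 * act x.2 y.1, x.2 * y.2).
Definition sd_inv (x : sdp) : sdp :=
  (act x.2^-1 x.1^-1, x.2^-1).

Lemma act1 h : act h 1 = 1.
Proof. by apply: (mulgI (act h 1)); rewrite -group_act_morph !mulg1. Qed.

Lemma sd_mulA : associative sd_mul.
Proof.
move=> x y z; congr (_, _); last exact: mulgA.
by rewrite /= group_act_morph group_actM mulgA.
Qed.
Lemma sd_mul1 : left_id sd_one sd_mul.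
Proof. by case=> x h; rewrite /sd_mul /= group_act1 !mul1g. Qed.
Lemma sd_1mul : right_id sd_one sd_mul.
Proof. by case=> x h; rewrite /sd_mul /= act1 !mulg1. Qed.
Lemma sd_mulV : left_inverse sd_one sd_inv sd_mul.
Proof.
by case=> x h; rewrite /sd_mul /= -group_act_morph !mulVg act1.
Qed.
Lemma sd_Vmul : right_inverse sd_one sd_inv sd_mul.
Proof.
by case=> x h; rewrite /sd_mul /= -group_actM !mulgV group_act1 mulgV.
Qed.
HB.instance Definition _ := isGroup.Build sdp
  sd_mulA sd_mul1 sd_1mul sd_mulV sd_Vmul.
End SemidirectProduct.
Arguments semidirect : clear implicits.

Definition group_isomorphic (G H : groupType) : Prop :=
  exists f : {multiplicative G -> H}, bijective f.

Section UnitGroup.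
Variable R : unitRingType.

Record unitgrp := Unitgrp { unitgrp_val : R; _ : unitgrp_val \is a GRing.unit }.
HB.instance Definition _ := [isSub for unitgrp_val].
HB.instance Definition _ := [Choice of unitgrp by <:].

Lemma unitgrpP (x : unitgrp) : val x \is a GRing.unit. Proof. by case: x. Qed.

Definition unitgrp_one : unitgrp := Unitgrp (unitr1 R).
Lemma unitgrp_mul_subproof (x y : unitgrp) : val x * val y \is a GRing.unit.
Proof. by rewrite unitrMl unitgrpP. Qed.
Definition unitgrp_mul (x y : unitgrp) : unitgrp :=
  Unitgrp (unitgrp_mul_subproof x y).
Lemma unitgrp_inv_subproof (x : unitgrp) : (val x)^-1 \is a GRing.unit.
Proof. by rewrite unitrV unitgrpP. Qed.
Definition unitgrp_inv (x : unitgrp) : unitgrp :=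
  Unitgrp (unitgrp_inv_subproof x).

Lemma unitgrp_mulA : associative unitgrp_mul.
Proof. by move=> x y z; apply: val_inj; exact: mulrA. Qed.
Lemma unitgrp_mul1 : left_id unitgrp_one unitgrp_mul.
Proof. by move=> x; apply: val_inj; exact: mul1r. Qed.
Lemma unitgrp_1mul : right_id unitgrp_one unitgrp_mul.
Proof. by move=> x; apply: val_inj; exact: mulr1. Qed.
Lemma unitgrp_mulV : left_inverse unitgrp_one unitgrp_inv unitgrp_mul.
Proof. by move=> x; apply: val_inj; exact: mulVr (unitgrpP x). Qed.
Lemma unitgrp_Vmul : right_inverse unitgrp_one unitgrp_inv unitgrp_mul.
Proof. by move=> x; apply: val_inj; exact: divrr (unitgrpP x). Qed.
HB.instance Definition _ := isGroup.Build unitgrp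
  unitgrp_mulA unitgrp_mul1 unitgrp_1mul unitgrp_mulV unitgrp_Vmul.
End UnitGroup.

Section Gamma.
Variables (A : comNzRingType) (n : nat) (l : 'I_n.+1 -> A).
Local Notation Z := 'rV[int]_n.+1.
Local Notation R := (Rd l).

Definition Gamma_mx (k : Z) (P : R) : 'M[R]_(1 + 1) :=
  block_mx (lmonom l k)%:M P%:M 0 1%:M.

Record Gamma := GammaElt {
  Gamma_val :> 'M[R]_(1 + 1);
  _ : `[< exists k P, Gamma_val = Gamma_mx k P >] }.
HB.instance Definition _ := [isSub for Gamma_val].
HB.instance Definition _ := [Choice of Gamma by <:].

Lemma GammaP (M : Gamma) : exists k P, M = Gamma_mx k P :> 'M_(1 + 1).
Proof. by case: M => M MP; apply/asboolP. Qed.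

Lemma Gamma_mxM k P m Q :
  Gamma_mx k P *m Gamma_mx m Q = Gamma_mx (k + m) (lmonom l k * Q + P).
Proof.
rewrite /Gamma_mx mulmx_block !mulmx0 !mul0mx !addr0 add0r !mulmx1.
by rewrite -!scalar_mxM -lmonomD -raddfD.
Qed.

Lemma Gamma_mx0 : Gamma_mx 0 0 = 1%:M.
Proof. by rewrite /Gamma_mx lmonom0 raddf0 -scalar_mx_block. Qed.

Lemma Gamma_mxV k P :
  invmx (Gamma_mx k P) = Gamma_mx (- k) (- (lmonom l (- k) * P)).
Proof.
have VM : Gamma_mx (- k) (- (lmonom l (- k) * P)) *m Gamma_mx k P = 1%:M.
  by rewrite Gamma_mxM addNr subrr Gamma_mx0.
have [_ uM] := mulmx1_unit VM.
by rewrite -[LHS]mul1mx -VM mulmxK.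
Qed.

Lemma Gamma_mul_subproof (M N : Gamma) :
  `[< exists k P, M *m N = Gamma_mx k P >].
Proof.
have [k [P ->]] := GammaP M; have [m [Q ->]] := GammaP N.
by apply/asboolP; rewrite Gamma_mxM; do 2!eexists.
Qed.
Lemma Gamma_one_subproof :
  `[< exists k P, 1%:M = Gamma_mx k P >].
Proof. by apply/asboolP; exists 0, 0; rewrite Gamma_mx0. Qed.
Lemma Gamma_inv_subproof (M : Gamma) :
  `[< exists k P, invmx M = Gamma_mx k P >].
Proof.
have [k [P ->]] := GammaP M.
by apply/asboolP; rewrite Gamma_mxV; do 2!eexists.
Qed.

Definition Gamma_mul (M N : Gamma) : Gamma := GammaElt (Gamma_mul_subproof M N).
Definition Gamma_one : Gamma := GammaElt Gamma_one_subproof.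
Definition Gamma_inv (M : Gamma) : Gamma := GammaElt (Gamma_inv_subproof M).

Lemma Gamma_unitmx (M : Gamma) : (M : 'M_(1 + 1)) \in unitmx.
Proof.
have [k [P ->]] := GammaP M.
have /mulmx1_unit[//] : Gamma_mx k P *m
  Gamma_mx (- k) (- (lmonom l (- k) * P)) = 1%:M.
rewrite Gamma_mxM addrN mulrN mulrA -lmonomD addrN lmonom0 mul1r addNr.
exact: Gamma_mx0.
Qed.

Lemma Gamma_mulA : associative Gamma_mul.
Proof. by move=> L M N; apply: val_inj; exact: mulmxA. Qed.
Lemma Gamma_mul1 : left_id Gamma_one Gamma_mul.
Proof. by move=> M; apply: val_inj; exact: mul1mx. Qed.
Lemma Gamma_1mul : right_id Gamma_one Gamma_mul.
Proof. by move=> M; apply: val_inj; exact: mulmx1. Qed.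
Lemma Gamma_mulV : left_inverse Gamma_one Gamma_inv Gamma_mul.
Proof. by move=> M; apply: val_inj; exact: mulVmx (Gamma_unitmx M). Qed.
Lemma Gamma_Vmul : right_inverse Gamma_one Gamma_inv Gamma_mul.
Proof. by move=> M; apply: val_inj; exact: mulmxV (Gamma_unitmx M). Qed.
HB.instance Definition _ := isGroup.Build Gamma
  Gamma_mulA Gamma_mul1 Gamma_1mul Gamma_mulV Gamma_Vmul.
End Gamma.

Section Derivations.
Variables (A : comNzRingType) (n : nat) (l : 'I_n.+1 -> A).
Local Notation Z := 'rV[int]_n.+1.
Local Notation R := (Rd l).

Definition is_der (delta : Z -> R) : Prop :=
  forall v w, delta (v + w) = delta v + delta w * lmonom l v.

Record Der := DerElt { Der_fun :> Z -> R; _ : `[< is_der Der_fun >] }.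
HB.instance Definition _ := [isSub for Der_fun].
HB.instance Definition _ := [Choice of Der by <:].

Lemma DerP (delta : Der) : is_der delta.
Proof. by case: delta => f fP; apply/asboolP. Qed.

Lemma Der_ext (delta eps : Der) : delta =1 eps -> delta = eps.
Proof. by move=> e; apply: val_inj; apply/funext. Qed.

Lemma Der_zero_subproof : `[< is_der (fun=> 0) >].
Proof. by apply/asboolP => v w; rewrite mul0r addr0. Qed.
Lemma Der_add_subproof (delta eps : Der) :
  `[< is_der (fun v => delta v + eps v) >].
Proof. by apply/asboolP => v w; rewrite !DerP mulrDl addrACA. Qed.
Lemma Der_opp_subproof (delta : Der) : `[< is_der (fun v => - delta v) >].
Proof. by apply/asboolP => v w; rewrite DerP opprD mulNr. Qed.

Definition Der_zero : Der := DerElt Der_zero_subproof.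
Definition Der_add (delta eps : Der) : Der :=
  DerElt (Der_add_subproof delta eps).
Definition Der_opp (delta : Der) : Der := DerElt (Der_opp_subproof delta).

Lemma Der_addA : associative Der_add.
Proof. by move=> d e f; apply: Der_ext => v; exact: addrA. Qed.
Lemma Der_add0 : left_id Der_zero Der_add.
Proof. by move=> d; apply: Der_ext => v; exact: add0r. Qed.
Lemma Der_0add : right_id Der_zero Der_add.
Proof. by move=> d; apply: Der_ext => v; exact: addr0. Qed.
Lemma Der_addN : left_inverse Der_zero Der_opp Der_add.
Proof. by move=> d; apply: Der_ext => v; exact: addNr. Qed.
Lemma Der_Nadd : right_inverse Der_zero Der_opp Der_add.
Proof. by move=> d; apply: Der_ext => v; exact: addrN. Qed.
(* The additive group of derivations, as a groupType: its product is the
   pointwise sum *)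
HB.instance Definition _ := isGroup.Build Der
  Der_addA Der_add0 Der_0add Der_addN Der_Nadd.
End Derivations.

Section Actions.
Variables (A : comNzRingType) (n : nat) (l : 'I_n.+1 -> A).
Local Notation Z := 'rV[int]_n.+1.
Local Notation R := (Rd l).

Lemma ker_stable_bij (beta : Z -> Z) : ker_stable l beta -> bijective beta.
Proof. by case. Qed.

(* The automorphisms beta of Z^(n.+1) such that K^beta = K *)
Definition StabK : Type := bijgrp (BijSet ker_stable_bij (ker_stable_id l)
  (@ker_stable_comp _ _ l) (@ker_stable_inv _ _ l)).
HB.instance Definition _ := Group.on StabK.

Lemma StabKP (beta : StabK) : ker_stable l beta.
Proof. by have := bijgrpP beta. Qed.

Lemma unit_act_subproof (beta : StabK) (S : unitgrp R) :
  Rd_act l beta (val S) \is a GRing.unit.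
Proof.
have [b1 bM] := Rd_act_monoid (StabKP beta).
by apply/unitrP; exists (Rd_act l beta (val S)^-1);
  rewrite -!bM mulVr ?mulrV ?unitgrpP.
Qed.

Definition unit_act_fun (beta : StabK) (S : unitgrp R) : unitgrp R :=
  Unitgrp (unit_act_subproof beta S).

Lemma unit_act1 S : unit_act_fun 1%g S = S.
Proof. by apply: val_inj; exact: Rd_act_id. Qed.
Lemma unit_actM (beta gamma : StabK) S :
  unit_act_fun (beta * gamma)%g S = unit_act_fun beta (unit_act_fun gamma S).
Proof. by apply: val_inj; apply: Rd_act_comp; exact: StabKP. Qed.
Lemma unit_act_morph beta : {morph unit_act_fun beta : S T / (S * T)%g}.
Proof.
move=> S T; apply: val_inj.
by have [_ bM] := Rd_act_monoid (StabKP beta); exact: bM.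
Qed.
Definition unit_act : group_action StabK (unitgrp R) :=
  GroupAction unit_act1 unit_actM unit_act_morph.

(* alpha_(R, beta) : S |-> R S^beta *)
Definition affine_act (h : semidirect (unitgrp R) StabK unit_act) (S : R) : R :=
  val h.1 * Rd_act l h.2 S.

Local Notation UK := (semidirect (unitgrp R) StabK unit_act).

Lemma der_act_subproof (h : UK) (delta : Der l) :
  `[< is_der (affine_act h \o delta \o (h.2^-1)%g) >].
Proof.
case: h => S beta; apply/asboolP => v w; rewrite /= /affine_act /=.
have [_ VD _] := StabKP (beta^-1)%g.
have bB := Rd_act_zmod (StabKP beta).
have [_ bM] := Rd_act_monoid (StabKP beta).
have bD := zmod_morphD bB.
rewrite VD DerP bD bM mulrDr mulrA Rd_act_lmonom ?bijgrp_Kinv //.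
exact: StabKP.
Qed.

Definition der_act_fun (h : UK) (delta : Der l) : Der l :=
  DerElt (der_act_subproof h delta).

Lemma der_act1 delta : der_act_fun 1%g delta = delta.
Proof.
apply: Der_ext => v; rewrite /= /affine_act /= mul1r [LHS]Rd_act_id.
rewrite (_ : ((1 : StabK)^-1)%g v = v) //.
exact: (@bijgrp_Kinv _ _ (1 : StabK)%g v).
Qed.
Lemma der_actM h k delta :
  der_act_fun (h * k)%g delta = der_act_fun h (der_act_fun k delta).
Proof.
case: h k => S beta [T gamma]; apply: Der_ext => v; rewrite /= /affine_act /=.
have [_ bM] := Rd_act_monoid (StabKP beta).
rewrite bM mulrA invgM; congr (_ * _).
by apply: Rd_act_comp; exact: StabKP.
Qed.
Lemma der_act_morph h : {morph der_act_fun h : delta eps / (delta * eps)%g}.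
Proof.
case: h => S beta delta eps; apply: Der_ext => v; rewrite /= /affine_act /=.
have bB := Rd_act_zmod (StabKP beta).
have bD := zmod_morphD bB.
by rewrite bD mulrDr.
Qed.
Definition der_act : group_action UK (Der l) :=
  GroupAction der_act1 der_actM der_act_morph.
End Actions.

(* Main.v *)
Require Import Defs.
From HB Require Import structures.
From mathcomp Require Import all_boot all_order all_algebra.
From mathcomp Require Import boolp classical_sets.

Set Implicit Arguments.
Unset Strict Implicit.
Unset Printing Implicit Defensive.

Import GRing.Theory.

Local Open Scope ring_scope.

(** The theorem holds because the copy of R = R_d(Z_q) inside Gamma_d(q) is
    visible to the group structure alone: it is the set of torsion elements.
    Indeed the differences l_i - l_j are units, so v |-> prod_i (t + l_i)^(v_i)
    is injective (lmonom_inj); hence every element of Gamma_d(q) has a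
    well-defined exponent in Z^(d-1), an element of finite order has exponent 0
    as Z^(d-1) is torsion-free, and conversely the elements of exponent 0 form
    the group R, which is killed by q.

    Write (v, P) for the matrix with exponent v and upper right entry P. An
    automorphism phi therefore restricts to an additive bijection a of R and
    induces an automorphism beta of Z^(d-1). Applying phi to (v, 0) (0, P)
    shows that a (x^v P) = x^(beta v) a(P), where x^v is the monomial with exponent v.
    As the monomials generate R additively, together with the scalars in Z_q,
    which are integers, a is determined by u = a(1) and beta:
    it sends the image of an element g of the group ring to u times the image of
    g^beta (aut_base_map). Bijectivity of a then forces u to be a unit, and
    u being a unit forces K^beta = K; so a is S |-> u S^beta. The only other
    datum of phi is the upper right entry of phi (v, 0), which is a derivation
    once it is precomposed with beta^-1. This yields
      phi (v, P) = (beta v, u P^beta + delta (beta v)).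
    Conversely this formula defines an automorphism for each triple
    (delta, (u, beta)), composition of automorphisms is the product of the
    iterated semidirect product (sd_autM), and the triple can be read off from
    the images of the elements (v, 0) and (0, 1) (sd_aut_inj). *)

(** * The monomials in the t + l_i are pairwise distinct *)

Section PolynomialEmbedding.
Variables (A : comNzRingType) (n : nat) (l : 'I_n.+1 -> A).

(** The denominators are monic, hence not zero divisors. *)
Lemma poly_to_Rd_inj : injective (poly_to_Rd l).
Proof.
move=> p q /Loc.eqmodP_[u /asboolP[e uE]] /=; rewrite !mulr1.
apply: monic_lreg; rewrite uE.
by apply: monic_prod => i _; apply: monic_exp; exact: monicXaddC.
Qed.

End PolynomialEmbedding.

Section DistinctMonomials.
Variables (A : comUnitRingType) (n : nat) (l : 'I_n.+1 -> A).
Hypothesis l_unit : forall i j, i != j -> l i - l j \is a GRing.unit.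

(** Evaluation at - l_i kills the factor t + l_i and makes every other factor
    the unit l_j - l_i. *)
Lemma lfactor_prod_coprime (e f : 'I_n.+1 -> nat) i : f i = 0%N ->
  \prod_j lfactor l j ^+ e j = \prod_j lfactor l j ^+ f j -> e i = 0%N.
Proof.
move=> fi /(congr1 (horner^~ (- l i))); rewrite !horner_prod => ef.
have unit_f : \prod_j (lfactor l j ^+ f j).[- l i] \is a GRing.unit.
  apply: rpred_prod => j _; rewrite horner_exp hornerD hornerX hornerC addrC.
  have [->|ji] := eqVneq j i; first by rewrite fi expr0 unitr1.
  by rewrite unitrX // l_unit.
case ei: (e i) => [//|k]; move: unit_f; rewrite -ef (bigD1 i) //= ei.
by rewrite horner_exp hornerD hornerX hornerC addNr expr0n mul0r unitr0.
Qed.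

Lemma lmonom_eq1 v : lmonom l v = 1 -> v = 0.
Proof.
pose e i := if v 0 i is Posz k then k else 0%N.
pose f i := if v 0 i is Negz k then k.+1 else 0%N.
have vE : v = \row_i (e i)%:Z - \row_i (f i)%:Z.
  apply/rowP => i; rewrite !mxE /e /f; case: (v 0 i) => k.
    by rewrite subr0.
  by rewrite sub0r NegzE.
move=> v1; have := congr1 ( *%R^~ (lmonom l (\row_i (f i)%:Z))) v1.
rewrite mul1r -lmonomD {1}vE subrK !lmonomE => /poly_to_Rd_inj ef.
apply/rowP => i; rewrite mxE.
have [ei fi] : e i = 0%N /\ f i = 0%N.
  have [ei|fi] : e i = 0%N \/ f i = 0%N.
  - by rewrite /e /f; case: (v 0 i); [right|left].
  - by split=> //; exact: lfactor_prod_coprime ei (esym ef).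
  - by split=> //; exact: lfactor_prod_coprime fi ef.
by rewrite vE !mxE ei fi subrr.
Qed.

Lemma lmonom_inj : injective (lmonom l).
Proof.
move=> v w vw; apply/eqP; rewrite -subr_eq0; apply/eqP/lmonom_eq1.
by rewrite lmonomD vw -lmonomD subrr lmonom0.
Qed.
End DistinctMonomials.

(** * Coordinates on the matrix group *)

Section Coordinates.
Variables (A : comNzRingType) (n : nat) (l : 'I_n.+1 -> A).
Hypothesis l_inj : injective (lmonom l).
Local Notation Z := 'rV[int]_n.+1.
Local Notation R := (Rd l).
Local Notation G := (Gamma l).

Lemma gelt_subproof (k : Z) (P : R) :
  `[< exists k' P', Gamma_mx k P = Gamma_mx k' P' >].
Proof. by apply/asboolP; exists k, P. Qed.

Definition gelt (k : Z) (P : R) : G := GammaElt (gelt_subproof k P).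

Lemma geltM k P m Q :
  (gelt k P * gelt m Q)%g = gelt (k + m) (lmonom l k * Q + P).
Proof. by apply: val_inj; exact: Gamma_mxM. Qed.

Lemma gelt1 : gelt 0 0 = 1%g.
Proof. by apply: val_inj; exact: Gamma_mx0. Qed.

Lemma gelt_inj k P m Q : gelt k P = gelt m Q -> k = m /\ P = Q.
Proof.
move=> /(congr1 val) /= /eq_block_mx[km PQ _ _].
split; last by move: PQ => /(congr1 (fun M : 'M_1 => M 0 0)); rewrite !mxE.
apply: l_inj.
by move: km => /(congr1 (fun M : 'M_1 => M 0 0)); rewrite !mxE.
Qed.

Lemma gelt_ex (M : G) : exists kP : Z * R, M = gelt kP.1 kP.2.
Proof.
by have [k [P MP]] := GammaP M; exists (k, P); apply: val_inj.
Qed.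

(** The two coordinates of a matrix are picked by choice; they are well defined
    as monomials with distinct exponents are distinct. *)
Definition gexp (M : G) : Z := (projT1 (cid (gelt_ex M))).1.
Definition gpar (M : G) : R := (projT1 (cid (gelt_ex M))).2.

Lemma geltE M : M = gelt (gexp M) (gpar M).
Proof. by rewrite /gexp /gpar; case: cid. Qed.

Lemma gexp_gelt k P : gexp (gelt k P) = k.
Proof. by have [] := gelt_inj (geltE (gelt k P)). Qed.

Lemma gpar_gelt k P : gpar (gelt k P) = P.
Proof. by have [] := gelt_inj (geltE (gelt k P)). Qed.

Lemma gexpM (M N : G) : gexp (M * N)%g = gexp M + gexp N.
Proof. by rewrite [M]geltE [N]geltE geltM !gexp_gelt. Qed.

Lemma gexpX (M : G) k : gexp (M ^+ k)%g = gexp M *+ k.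
Proof.
elim: k => [|k IHk]; first by rewrite expg0 -gelt1 gexp_gelt mulr0n.
by rewrite expgS gexpM IHk mulrS.
Qed.

(** One half of the description of R inside the group as the torsion elements;
    gelt0X gives the other half in positive characteristic. *)
Lemma gexp_torsion (M : G) k : (0 < k)%N -> (M ^+ k = 1)%g -> gexp M = 0.
Proof.
move=> k_gt0 /(congr1 gexp); rewrite gexpX -gelt1 gexp_gelt => Mk.
apply/rowP => i; have /rowP/(_ i) := Mk; rewrite !mxE.
by rewrite mulmxnE => /eqP; rewrite Num.Theory.mulrn_eq0 eqn0Ngt k_gt0 => /eqP.
Qed.

Lemma gelt0X P k : (gelt 0 P ^+ k)%g = gelt 0 (P *+ k).
Proof.
elim: k => [|k IHk]; first by rewrite expg0 gelt1.
by rewrite expgS IHk geltM addr0 lmonom0 mul1r mulrSr.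
Qed.

(** * The automorphism attached to a triple (delta, (u, beta)) *)

Local Notation SD :=
  (semidirect (Der l) (semidirect (unitgrp R) (StabK l) (unit_act l))
     (der_act l)).

(** The formula (v, P) |-> (beta v, u P^beta + delta (beta v)). The derivation
    is evaluated at beta v, not at v, to match the action
    delta |-> alpha o delta o beta^-1 in the semidirect product. *)
Definition sd_aut_fun (h : SD) (M : G) : G :=
  gelt (h.2.2 (gexp M)) (affine_act h.2 (gpar M) + h.1 (h.2.2 (gexp M))).

Lemma sd_aut_funE (h : SD) k P :
  sd_aut_fun h (gelt k P) =
    gelt (h.2.2 k) (affine_act h.2 P + h.1 (h.2.2 k)).
Proof. by rewrite /sd_aut_fun gexp_gelt gpar_gelt. Qed.

Lemma affine_actD h : {morph @affine_act _ _ l h : P Q / P + Q}.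
Proof.
move=> P Q; rewrite /affine_act (zmod_morphD (Rd_act_zmod (StabKP h.2))).
exact: mulrDr.
Qed.

Lemma affine_act_lmonom h k P :
  affine_act (l := l) h (lmonom l k * P) = lmonom l (h.2 k) * affine_act h P.
Proof.
rewrite /affine_act; have [_ ->] := Rd_act_monoid (StabKP h.2).
by rewrite (Rd_act_lmonom _ (StabKP h.2)) mulrCA.
Qed.

Lemma affine_act1 h : affine_act (l := l) h 1 = val h.1.
Proof.
rewrite /affine_act; have [-> _] := Rd_act_monoid (StabKP h.2).
exact: mulr1.
Qed.

Lemma affine_act0 h : affine_act (l := l) h 0 = 0.
Proof. by apply: (addrI (affine_act h 0)); rewrite -affine_actD !addr0. Qed.

Lemma sd_aut_fun_morph h : {morph sd_aut_fun h : M N / (M * N)%g}.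
Proof.
move=> M N; rewrite [M]geltE [N]geltE !(geltM, sd_aut_funE).
have [_ bD _] := StabKP h.2.2.
rewrite bD affine_actD affine_act_lmonom DerP mulrDr.
congr gelt; rewrite [RHS]addrACA; congr (_ + _).
by rewrite addrC mulrC.
Qed.

Lemma sd_aut_fun1 : sd_aut_fun 1%g =1 id.
Proof.
move=> M; rewrite [M]geltE sd_aut_funE; congr gelt.
rewrite [X in _ + X](_ : _ = 0) // addr0 /affine_act [LHS]mul1r.
exact: Rd_act_id.
Qed.

Lemma sd_aut_funM (g h : SD) :
  sd_aut_fun (g * h)%g =1 sd_aut_fun g \o sd_aut_fun h.
Proof.
case: g h => [delta [u beta]] [eps [v gamma]] M.
rewrite [M]geltE /= !sd_aut_funE /=; congr gelt; rewrite affine_actD.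
rewrite -addrA; congr (_ + _).
  rewrite /affine_act /=; have [_ ->] := Rd_act_monoid (StabKP beta).
  by rewrite mulrA; congr (_ * _); apply: Rd_act_comp; exact: StabKP.
set k := gexp M.
(* the two occurrences of beta cancel: delta^(u, beta) is precomposed with
   beta^-1, and is evaluated here at beta (gamma k) *)
rewrite -[LHS]/(delta (beta (gamma k)) +
  affine_act (u, beta) (eps ((beta^-1)%g (beta (gamma k))))).
by rewrite addrC (bijgrp_invK beta).
Qed.

(** Bijectivity is free: the triples form a group acting by composition. *)
Lemma sd_aut_subproof h : is_aut (sd_aut_fun h).
Proof.
split; last exact: sd_aut_fun_morph.
exists (sd_aut_fun h^-1%g) => M;
  by rewrite -[LHS]sd_aut_funM ?mulVg ?mulgV sd_aut_fun1.
Qed.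

Definition sd_aut (h : SD) : autgrp G :=
  to_bijgrp (B := BijSet (@is_aut_bij G) (is_aut_id G) (@is_aut_comp G)
    (@is_aut_inv G)) (sd_aut_subproof h).

Lemma sd_autM : {morph sd_aut : g h / (g * h)%g}.
Proof. by move=> g h; apply: bijgrp_ext => M; exact: sd_aut_funM. Qed.

(** The images of the elements (k, 0) give beta and then delta; the image of
    (0, 1) gives u. *)
Lemma sd_aut_inj : injective sd_aut.
Proof.
move=> g h /(congr1 (fun f : autgrp G => f : G -> G)) /= gh.
have {}gh k P := congr1 (fun f => f (gelt k P)) gh.
have betaE k : g.2.2 k = h.2.2 k.
  by have := gh k 0; rewrite !sd_aut_funE => /gelt_inj[].
have deltaE k : g.1 (g.2.2 k) = h.1 (g.2.2 k).
  have := gh k 0; rewrite !sd_aut_funE !affine_act0 !add0r betaE.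
  by move=> /gelt_inj[].
have unitE : val g.2.1 = val h.2.1.
  rewrite -!affine_act1; have := gh 0 1; rewrite !sd_aut_funE deltaE betaE.
  by move=> /gelt_inj[_ /addIr].
move: betaE deltaE unitE {gh}.
case: g h => [delta [u beta]] [eps [v gamma]] /= betaE deltaE unitE.
congr (_, (_, _)); last exact: bijgrp_ext; last exact: val_inj.
by apply: Der_ext => k; rewrite -[k](bijgrp_Kinv beta) deltaE.
Qed.

End Coordinates.

(** * Every automorphism arises from such a triple *)

Section Surjectivity.
Variables (q n : nat) (l : 'I_n.+1 -> 'Z_q).
Hypothesis q_gt1 : (1 < q)%N.
Hypothesis l_inj : injective (lmonom l).
Local Notation Z := 'rV[int]_n.+1.
Local Notation R := (Rd l).
Local Notation G := (Gamma l).

Lemma Rd_char (P : R) : P *+ q = 0.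
Proof.
rewrite -mulr_natr -(rmorph_nat (poly_to_Rd l)) -(rmorph_nat polyC).
by rewrite pchar_Zp // !rmorph0 mulr0.
Qed.

Section Automorphism.
Variable phi : autgrp G.

Let phiM : {morph phi : M N / (M * N)%g}.
Proof. by have [] := bijgrpP phi. Qed.

Lemma aut1 : phi 1%g = 1%g.
Proof. by apply: (mulgI (phi 1%g)); rewrite -phiM !mulg1. Qed.

Lemma autX M k : phi (M ^+ k)%g = (phi M ^+ k)%g.
Proof. by elim: k => [|k IHk]; rewrite ?expg0 ?aut1 // !expgS phiM IHk. Qed.

(** Automorphisms preserve R because they preserve torsion; everything below
    rests on this. *)
Lemma gexp_aut_gelt0 P : gexp (phi (gelt 0 P)) = 0.
Proof.
apply: (@gexp_torsion _ _ _ l_inj _ q); first exact: ltnW.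
by rewrite -autX gelt0X Rd_char gelt1 aut1.
Qed.

Definition aut_exp (v : Z) : Z := gexp (phi (gelt v 0)).
Definition aut_base (P : R) : R := gpar (phi (gelt 0 P)).
Definition aut_der (v : Z) : R := gpar (phi (gelt v 0)).

Lemma aut_gelt0 P : phi (gelt 0 P) = gelt 0 (aut_base P).
Proof. by rewrite [LHS]geltE gexp_aut_gelt0. Qed.

Lemma aut_gelt v P :
  phi (gelt v P) = gelt (aut_exp v) (aut_base P + aut_der v).
Proof.
have -> : gelt v P = (gelt 0 P * gelt v 0)%g :> G.
  by rewrite geltM add0r mulr0 add0r.
rewrite phiM aut_gelt0 [phi _]geltE geltM add0r lmonom0 mul1r addrC.
by rewrite -[gexp _]/(aut_exp v).
Qed.

Lemma aut_expD : {morph aut_exp : v w / v + w}.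
Proof.
move=> v w; rewrite -(gexpM l_inj) -phiM geltM mulr0 addr0.
by rewrite aut_gelt gexp_gelt.
Qed.

Lemma aut_baseD : {morph aut_base : P Q / P + Q}.
Proof.
move=> P Q; have := phiM (gelt 0 Q) (gelt 0 P).
rewrite !aut_gelt0 !geltM lmonom0 !mul1r addr0 aut_gelt0.
by move=> /(gelt_inj l_inj)[].
Qed.

Lemma aut_base_zmod : zmod_morphism aut_base.
Proof. by move=> P Q; apply/eqP; rewrite -subr_eq opprK -aut_baseD subrK. Qed.

Lemma aut_base0 : aut_base 0 = 0.
Proof. by rewrite -[X in aut_base X](subrr 0) aut_base_zmod subrr. Qed.

(** This is phi applied to the product of (v, 0) and (0, P): R is a module over
    the group ring of Z^(d-1), and phi is semilinear along beta. *)
Lemma aut_base_lmonom v P :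
  aut_base (lmonom l v * P) = lmonom l (aut_exp v) * aut_base P.
Proof.
have := phiM (gelt v 0) (gelt 0 P).
rewrite geltM !aut_gelt geltM => /(gelt_inj l_inj)[_].
rewrite !addr0.
have -> : aut_der 0 = 0 by rewrite /aut_der gelt1 aut1 -gelt1 gpar_gelt.
by rewrite aut_base0 add0r addr0 => /addIr.
Qed.

Lemma aut_derD v w :
  aut_der (v + w) = aut_der v + aut_der w * lmonom l (aut_exp v).
Proof.
have := phiM (gelt v 0) (gelt w 0).
rewrite geltM !aut_gelt geltM mulr0 addr0 => /(gelt_inj l_inj)[_].
by rewrite aut_base0 !add0r addrC mulrC => ->; rewrite addrC.
Qed.

(** A semilinear map is determined by its value at 1. Additivity of aut_base is
    enough to handle the coefficients, as each of them is a natural number. *)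
Lemma aut_base_map (g : gring 'Z_q Z) :
  aut_base (group_ring_map l g) =
  aut_base 1 * group_ring_map l (gpush aut_exp g).
Proof.
apply: (@gring_ext _ _ _ (fun g => aut_base (group_ring_map l g))
  (fun g => aut_base 1 * group_ring_map l (gpush aut_exp g))) g.
- exact: (zmod_comp aut_base_zmod (group_ring_map_zmod l)).
- by move=> g h; rewrite gpush_zmod group_ring_map_zmod mulrBr.
move=> x c; rewrite gpushU !group_ring_mapU -(natr_Zp c).
rewrite !rmorph_nat mulrC aut_base_lmonom mulrA -mulrA [_ * lmonom _ _]mulrC.
rewrite [RHS]mulrCA mulr_natr; congr (_ * _).
elim: (c : nat) => [|k IHk]; first by rewrite aut_base0.
by rewrite !mulrSr aut_baseD IHk.
Qed.
End Automorphism.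

Lemma aut_base_can (phi psi : autgrp G) : cancel phi psi ->
  cancel (aut_base phi) (aut_base psi).
Proof.
move=> phiK P; have := phiK (gelt 0 P).
by rewrite !aut_gelt0 => /(gelt_inj l_inj)[].
Qed.

Lemma aut_exp_can (phi psi : autgrp G) : cancel phi psi ->
  cancel (aut_exp phi) (aut_exp psi).
Proof.
move=> phiK v; have := phiK (gelt v 0).
by rewrite !aut_gelt => /(gelt_inj l_inj)[].
Qed.

Section Decomposition.
Variable phi : autgrp G.
Let psi : autgrp G := (phi^-1)%g.
Let phiK : cancel phi psi := bijgrp_invK phi.
Let psiK : cancel psi phi := bijgrp_Kinv phi.

(** If the image of g is the preimage of 1 under the additive bijection of R,
    then aut_base_map reads 1 = u times the image of g^beta. *)
Lemma aut_base1_unit : aut_base phi 1 \is a GRing.unit.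
Proof.
have [g gE] := group_ring_map_surj (aut_base psi 1).
have := aut_base_map phi g; rewrite gE (aut_base_can psiK) => u1.
apply/unitrP; exists (group_ring_map l (gpush (aut_exp phi) g)).
by rewrite mulrC.
Qed.

(** Both sides say that aut_base phi kills the image of g: one as this map is
    injective, the other as aut_base phi 1 is a unit. *)
Lemma ker_gpush_aut_exp (g : gring 'Z_q Z) :
  group_ring_map l (gpush (aut_exp phi) g) = 0 <-> group_ring_map l g = 0.
Proof.
split=> g0; last first.
  apply: (mulrI aut_base1_unit).
  by rewrite -aut_base_map g0 mulr0 aut_base0.
apply: (can_inj (aut_base_can phiK)).
by rewrite aut_base_map g0 mulr0 aut_base0.
Qed.

Lemma aut_exp_ker_stable : ker_stable l (aut_exp phi).
Proof.
split; first by exists (aut_exp psi); exact: aut_exp_can.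
  exact: aut_expD.
apply/seteqP; split=> [_ [g g0 <-]|g g0]; first exact/ker_gpush_aut_exp.
have gE : gpush (aut_exp phi) (gpush (aut_exp psi) g) = g.
  rewrite -gpush_comp (_ : aut_exp phi \o aut_exp psi = id) ?gpush_id //.
  by apply/funext; exact: aut_exp_can.
exists (gpush (aut_exp psi) g) => //.
by apply/ker_gpush_aut_exp; rewrite gE.
Qed.

Lemma aut_der_subproof : `[< is_der (l := l) (aut_der phi \o aut_exp psi) >].
Proof.
apply/asboolP => v w /=.
by rewrite aut_expD aut_derD (aut_exp_can psiK).
Qed.

Lemma sd_aut_surj : exists h, sd_aut l_inj h = phi.
Proof.
pose beta : StabK l := to_bijgrp (B := BijSet (@ker_stable_bij _ _ l)
  (ker_stable_id l) (@ker_stable_comp _ _ l) (@ker_stable_inv _ _ l))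
  aut_exp_ker_stable.
exists (DerElt aut_der_subproof, (Unitgrp aut_base1_unit, beta)).
apply: bijgrp_ext => M; rewrite [M]geltE [LHS](sd_aut_funE l_inj) aut_gelt.
congr gelt; rewrite /= /affine_act /= (aut_exp_can phiK); congr (_ + _).
have [g <-] := group_ring_map_surj (gpar M).
by rewrite Rd_act_map ?aut_base_map //; exact: aut_exp_ker_stable.
Qed.
End Decomposition.

Lemma sd_aut_bij : bijective (sd_aut l_inj).
Proof.
pose inv phi := projT1 (cid (sd_aut_surj phi)).
have invK : cancel inv (sd_aut l_inj) by move=> phi; rewrite /inv; case: cid.
by exists inv => // h; apply: (sd_aut_inj (l_inj := l_inj)); rewrite invK.
Qed.
End Surjectivity.

Lemma group_isomorphic_sym (G H : groupType) :
  group_isomorphic G H -> group_isomorphic H G.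
Proof.
move=> [f [g fK gK]].
have gM : {morph g : x y / (x * y)%g}.
  by move=> x y; apply: (can_inj fK); rewrite gmulfM !gK.
pose gm := isMultiplicative.Build H G g gM.
pose gL : {multiplicative H -> G} := HB.pack g gm.
by exists gL; exists f.
Qed.

Theorem theorem3p2 (d q : nat) (d_ge2 : (2 <= d)%N) (q_ge2 : (2 <= q)%N)
    (d_le : forall p : nat, prime p -> (p %| q)%N -> (d <= p.+1)%N)
    (l : 'I_(d.-2).+1 -> 'Z_q) (l_1 : l ord0 = 0)
    (l_unit : forall i j, i != j -> l i - l j \is a GRing.unit) :
  group_isomorphic (autgrp (Gamma l))
    (semidirect (Der l) (semidirect (unitgrp (Rd l)) (StabK l) (unit_act l))
       (der_act l)).
Proof.
apply: group_isomorphic_sym; pose l_inj := lmonom_inj l_unit.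
pose fm := isMultiplicative.Build _ _ (sd_aut l_inj) (sd_autM l_inj).
pose f : {multiplicative _ -> _} := HB.pack (sd_aut l_inj) fm.
by exists f; exact: sd_aut_bij.
Qed.
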